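(* Let $\{w_{0,\mathbf{i}}\}_{\mathbf{i}\in\mathbb{Z}^N}$ and $\{w_{1,\mathbf{i}}\}_{\mathbf{i}\in\mathbb{Z}^N}$ be two weight systems on the periodic graph with one vertex per period, and for $0\le s\le1$ let $w_{s,\mathbf{i}}=(1-s)w_{0,\mathbf{i}}+sw_{1,\mathbf{i}}$, with associated energy $\mathcal{E}_s$, vector $\mathbf{z}_s$, number $\overline W_s$ and energy loss ratio $R_s$ of the single splitting (all defined in the context). Suppose that $R_0=R_1$. Then \[ R_s=R_0-\frac{(1-s)s}{\overline W_s\mathcal{E}_s}\Big((\overline W_0\mathcal{E}_1+\overline W_1\mathcal{E}_0)R_0-2\,\mathbf{z}_0\cdot\mathbf{z}_1\Big)\ \le\ R_0 . \] The equality holds if and only if $\mathcal{E}_0/\overline W_0=\mathcal{E}_1/\overline W_1$ and the vectors $\mathbf{z}_0$ and $\mathbf{z}_1$ are parallel. For fixed $w_{0,\mathbf{i}}$ and $w_{1,\mathbf{i}}$, the minimum of $R_s$ is attained when \[ s=\hat s=\frac{\sqrt{\overline W_0\mathcal{E}_0}}{\sqrt{\overline W_0\mathcal{E}_0}+\sqrt{\overline W_1\mathcal{E}_1}} . \]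
   Context: Fix a basis $\mathbf{u}_1,\dots,\mathbf{u}_N$ of $\mathbb{R}^N$ and put $\mathbf{v}_{\mathbf{i}}=i_1\mathbf{u}_1+\dots+i_N\mathbf{u}_N$ for $\mathbf{i}\in\mathbb{Z}^N$. Fix a subset $I\subset\mathbb{Z}^N$ with $\mathbb{Z}^N=I\sqcup(-I)\sqcup\{0\}$ and a number $p\in[0,1]$ (the probability that a loop changes into a non-loop edge in the splitting). Graph $X_0$: the vertex set is $\mathbb{Z}^N$; for $\mathbf{i}\ne0$ there is an edge of weight $w_{\mathbf{i}}=w_{-\mathbf{i}}\ge0$ from $\mathbf{j}$ to $\mathbf{j}+\mathbf{i}$ for every $\mathbf{j}$ (the edge for $-\mathbf{i}$ starting at $\mathbf{j}+\mathbf{i}$ being its reversal), and each vertex carries a loop of weight $w_0\ge0$. The graph formed by the positive-weight edges is connected, and the sums over $I$ below converge (for both weight systems $w_{0,\mathbf{i}}$ and $w_{1,\mathbf{i}}$). It is realized by $\Phi_0(\mathbf{i})=\mathbf{v}_{\mathbf{i}}$. Graph $X_1$ (obtained by splitting the vertices): each vertex $\mathbf{j}$ is replaced by two vertices $(\mathbf{j},0),(\mathbf{j},1)$; for $\mathbf{i}\in I$ the edge from $\mathbf{j}$ to $\mathbf{j}+\mathbf{i}$ becomes an edge of weight $w_{\mathbf{i}}$ from $(\mathbf{j},1)$ to $(\mathbf{j}+\mathbf{i},0)$; the loop at $\mathbf{j}$ gives a non-loop edge of weight $w_0'=pw_0$ between $(\mathbf{j},0)$ and $(\mathbf{j},1)$,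 the remaining loop weight being distributed to loops on $(\mathbf{j},0)$ and $(\mathbf{j},1)$. $\Phi_1$ is the harmonic realization of $X_1$ with the same periods: $\Phi_1(\mathbf{j},0)=\mathbf{v}_{\mathbf{j}}$, $\Phi_1(\mathbf{j},1)=\mathbf{v}_{\mathbf{j}}+\mathbf{x}$, where $\mathbf{x}$ is determined by the condition that at every vertex the weighted sum of the outgoing edge vectors is $0$ (equivalently, the energy is minimal among periodic realizations with these periods). The energy per period $\mathcal{E}$ of a realized graph is the sum, over unoriented edges modulo translation by $\mathbb{Z}^N$, of weight times squared length of the edge vector (loops contribute $0$). The energy loss ratio is $R=(\mathcal{E}(X_0,\Phi_0)-\mathcal{E}(X_1,\Phi_1))/\mathcal{E}(X_0,\Phi_0)$. For the weight system $w_{s,\mathbf{i}}$, put $\mathcal{E}_s=\mathcal{E}(X_0,\Phi_0)=\sum_{\mathbf{i}\in I}w_{s,\mathbf{i}}\|\mathbf{v}_{\mathbf{i}}\|^2$, $\mathbf{z}_s=\sum_{\mathbf{i}\in I}w_{s,\mathbf{i}}\mathbf{v}_{\mathbf{i}}$, $\overline W_s=pw_{s,0}+\sum_{\mathbf{i}\in I}w_{s,\mathbf{i}}$, and let $R_s$ be the corresponding energy loss ratio; one has $R_s=\|\mathbf{z}_s\|^2/(\overline W_s\mathcal{E}_s)$.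
   Formalization: The equality criterion is stated for 0<s<1 only, ''parallel'' means positive multiples of each other (it fails for opposite directions), and R_0=0 is added as an alternative, since then R_s=R_0 for all s whatever the ratios of energy to total weight are. *)

(* Defs.v *)
From HB Require Import structures.
From mathcomp Require Import all_boot all_order all_algebra.
From mathcomp Require Import finmap.
From mathcomp Require Import boolp classical_sets reals topology normedtype.
From mathcomp.analysis.showcase Require Import summability.

Set Implicit Arguments.
Unset Strict Implicit.
Unset Printing Implicit Defensive.

Import Order.TTheory GRing.Theory Num.Theory numFieldNormedType.Exports.
Local Open Scope classical_set_scope.
Local Open Scope ring_scope.

(* Infinite sums are unconditional: limits of the finite partial sums along the
   directed set of finite subsets of the index type. *)
Section Sums.
Context {T : choiceType} {K : realType} {V : normedModType K}.

Definition has_sum (f : T -> V) (l : V) : Prop :=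
  partial_sum f @ totally --> l.

Definition extend0 (A : set T) (f : T -> V) : T -> V :=
  fun i => if i \in A then f i else 0.

Definition converges_on (A : set T) (f : T -> V) : Prop :=
  exists l, has_sum (extend0 A f) l.

Definition sum_on (A : set T) (f : T -> V) : V := sum (extend0 A f).

End Sums.

(* The canonical norm on ['rV_N] is the sup norm, hence these definitions. *)
Definition dot (R : realType) (N : nat) (a b : 'rV[R]_N) : R :=
  \sum_(k < N) a 0 k * b 0 k.

Definition sqnorm (R : realType) (N : nat) (a : 'rV[R]_N) : R := dot a a.

(* Collinear vectors of opposite directions are excluded: moving from z to a
   negative multiple of z passes through 0, where the energy loss vanishes. *)
Definition same_direction (R : realType) (N : nat) (a b : 'rV[R]_N) : Prop :=
  exists2 c : R, 0 < c & b = c *: a.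

(* Z^N is the disjoint union of I, -I and {0}. *)
Definition half_lattice (N : nat) (I : set 'rV[int]_N) : Prop :=
  [/\ I `|` [set - i | i in I] `|` [set 0] = setT,
      I `&` [set - i | i in I] = set0,
      ~ I 0 &
      ~ [set - i | i in I] 0].

Section PeriodicGraphs.
Variables (R : realType) (N : nat).

(* A periodic graph with set V of vertices per period has vertex set Z^N * V,
   on which Z^N acts by translation of the first component. The graphs below have
   at most one edge between two vertices, so they are given by a (symmetric,
   translation-invariant) weight function, the value 0 meaning "no edge". *)
Definition wgraph (V : finType) :=
  ('rV[int]_N * V)%type -> ('rV[int]_N * V)%type -> R.

Definition realization (V : finType) := ('rV[int]_N * V)%type -> 'rV[R]_N.

Definition connected_graph (V : finType) (g : wgraph V) : Prop :=
  forall x y, exists p : seq ('rV[int]_N * V),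
    path (fun a b => 0 < g a b) x p /\ last x p = y.

Definition harmonic (V : finType) (g : wgraph V) (Phi : realization V) : Prop :=
  forall x, has_sum (fun y => g x y *: (Phi y - Phi x)) 0.

(* An edge cannot be reversed by a translation, so each translation class of
   unoriented non-loop edges has exactly two orientations starting in the
   fundamental domain {0} * V; hence the factor 1/2. *)
Definition energy (V : finType) (g : wgraph V) (Phi : realization V) : R :=
  2^-1 * \sum_(a : V) sum (fun y => g (0, a) y * sqnorm (Phi y - Phi (0, a))).

Variable u : N.-tuple 'rV[R]_N.

Definition latvec (i : 'rV[int]_N) : 'rV[R]_N :=
  \sum_(k < N) (i 0 k)%:~R *: tnth u k.

Definition X0 (w : 'rV[int]_N -> R) : wgraph unit :=
  fun x y => w (y.1 - x.1).

Definition Phi0 : realization unit := fun x => latvec x.1.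

Record weight_system (I : set 'rV[int]_N) (w : 'rV[int]_N -> R) : Prop := {
  weight_ge0 : forall i, 0 <= w i;
  weight_sym : forall i, w (- i) = w i;
  weight_connected : connected_graph (X0 w);
  weight_cvg : converges_on I w;
  weight_cvg_vec : converges_on I (fun i => w i *: latvec i);
  weight_cvg_energy : converges_on I (fun i => w i * sqnorm (latvec i))
}.

Variables (I : set 'rV[int]_N) (p q : R).

(* The weight of the edge from (j, 1) to (j + i, 0) after the splitting. *)
Definition split_weight (w : 'rV[int]_N -> R) (i : 'rV[int]_N) : R :=
  if i == 0 then p * w 0 else if i \in I then w i else 0.

(* The vertices (j, 0) and (j, 1) are (j, false) and (j, true). A proportion p
   of the loop weight goes to the edge between them; a proportion q of the rest
   goes to the loop at (j, 0), and what remains to the loop at (j, 1). *)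
Definition X1 (w : 'rV[int]_N -> R) : wgraph bool := fun x y =>
  match x.2, y.2 with
  | true, false => split_weight w (y.1 - x.1)
  | false, true => split_weight w (x.1 - y.1)
  | false, false => if y.1 == x.1 then q * ((1 - p) * w 0) else 0
  | true, true => if y.1 == x.1 then (1 - q) * ((1 - p) * w 0) else 0
  end.

Definition Phi1 (x : 'rV[R]_N) : realization bool :=
  fun y => latvec y.1 + (if y.2 then x else 0).

Definition harmonic_offset (w : 'rV[int]_N -> R) : 'rV[R]_N :=
  xget 0 [set x | harmonic (X1 w) (Phi1 x)].

Definition energy_loss_ratio (w : 'rV[int]_N -> R) : R :=
  (energy (X0 w) Phi0 - energy (X1 w) (Phi1 (harmonic_offset w)))
    / energy (X0 w) Phi0.

Definition zvec (w : 'rV[int]_N -> R) : 'rV[R]_N :=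
  sum_on I (fun i => w i *: latvec i).

Definition Wbar (w : 'rV[int]_N -> R) : R := p * w 0 + sum_on I w.

End PeriodicGraphs.

Definition interpolate (R : realType) (N : nat) (w0 w1 : 'rV[int]_N -> R)
    (s : R) : 'rV[int]_N -> R :=
  fun i => (1 - s) * w0 i + s * w1 i.

(* Main.v *)
(* With S the sum of the w_i over I and W = p w_0 + S, the realization Phi1 with
   offset x is harmonic iff W x = z, and its energy is E - 2 x.z + W |x|^2;
   hence the ratio is |z|^2 / (W E). Along the segment W, E and z are affine in
   s. If |z_k|^2 = r W_k E_k for k = 0, 1, expanding |z_s|^2 gives
   R_s = r - s (1 - s) D / (W_s E_s) with
   D = (W_0 E_1 + W_1 E_0) r - 2 z_0.z_1, and D >= 0 by Cauchy-Schwarz and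
   AM-GM. The minimum is reached where s (1 - s) / (W_s E_s) is maximal; with
   t_k = sqrt (W_k E_k), W_s E_s is the sum of ((1 - s) t_0 - s t_1)^2 and of a
   constant multiple of s (1 - s). *)

Require Import Defs.
From HB Require Import structures.
From mathcomp Require Import all_boot all_order all_algebra.
From mathcomp Require Import finmap ring lra.
From mathcomp Require Import boolp classical_sets reals topology normedtype.
From mathcomp.analysis.showcase Require Import summability.

Set Implicit Arguments.
Unset Strict Implicit.
Unset Printing Implicit Defensive.

Import Order.TTheory GRing.Theory Num.Theory numFieldNormedType.Exports.
Local Open Scope classical_set_scope.
Local Open Scope ring_scope.

(** * Unconditional sums in normed modules *)

Lemma partial_sumE (T : choiceType) (V : zmodType) (f : T -> V) (B : {fset T}) :
  partial_sum f B = \sum_(i <- B) f i.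
Proof. by rewrite /partial_sum big_seq_fsetE. Qed.

#[local] Existing Instance totally_filter.

Section HasSum.
Context {K : realType}.
Implicit Types V : normedModType K.

Lemma has_sum_sum (T : choiceType) V (f : T -> V) l : has_sum f l -> sum f = l.
Proof. by move=> fl; apply: (cvg_lim _ fl); exact: (@norm_hausdorff K V). Qed.

Lemma has_sum_unique (T : choiceType) V (f : T -> V) l m :
  has_sum f l -> has_sum f m -> l = m.
Proof. by move=> /has_sum_sum <- /has_sum_sum <-. Qed.

Lemma eq_has_sum (T : choiceType) V (f g : T -> V) l :
  f =1 g -> has_sum f l -> has_sum g l.
Proof. by move=> /funext ->. Qed.

Lemma has_sumD (T : choiceType) V (f g : T -> V) l m :
  has_sum f l -> has_sum g m -> has_sum (fun i => f i + g i) (l + m).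
Proof.
move=> fl gm; rewrite /has_sum.
have -> : partial_sum (fun i => f i + g i) = partial_sum f \+ partial_sum g.
  by apply/funext => B; rewrite /= /partial_sum big_split.
exact: cvgD.
Qed.

(** Additivity commutes [h] with finite partial sums, and continuity passes to the limit. Scalings,
    negation and inner products are all instances. *)
Lemma has_sum_map (T : choiceType) V (W : normedModType K) (h : V -> W)
    (f : T -> V) l :
  {morph h : x y / x + y} -> continuous h ->
  has_sum f l -> has_sum (h \o f) (h l).
Proof.
move=> hD hc fl; rewrite /has_sum.
have h0 : h 0 = 0 by apply: (addrI (h 0)); rewrite -hD !addr0.
have -> : partial_sum (h \o f) = h \o partial_sum f.
  by apply/funext => B; rewrite /= /partial_sum (big_morph h hD h0).
exact: continuous_cvg (hc _) fl.
Qed.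

Lemma has_sumZ (T : choiceType) V (a : K) (f : T -> V) l :
  has_sum f l -> has_sum (fun i => a *: f i) (a *: l).
Proof.
apply: (has_sum_map (h := fun v => a *: v)) => [x y|]; first exact: scalerDr.
exact: scaler_continuous.
Qed.

Lemma has_sumM (T : choiceType) (a : K) (f : T -> K) (l : K) :
  has_sum f l -> has_sum (fun i => a * f i) (a * l).
Proof. exact: (@has_sumZ T K). Qed.

Lemma has_sumZl (T : choiceType) V (f : T -> K) (l : K) (v : V) :
  has_sum f l -> has_sum (fun i => f i *: v) (l *: v).
Proof.
apply: (has_sum_map (h := fun a : K => a *: v)) => [x y|]; first exact: scalerDl.
exact: scalel_continuous.
Qed.

Lemma has_sumN (T : choiceType) V (f : T -> V) l :
  has_sum f l -> has_sum (fun i => - f i) (- l).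
Proof.
apply: (has_sum_map (h := -%R)) => [x y|]; first exact: opprD.
exact: opp_continuous.
Qed.

(** [h] is injective and [f] vanishes off its image, the points outside the image being those with
    [h (h' t) != t]. This transfers sums over edge labels in Z^N to sums over all vertices of a
    graph. *)
Lemma has_sum_reindex (S T : choiceType) V (h : S -> T) (h' : T -> S)
    (f : T -> V) l :
  cancel h h' -> (forall t, h (h' t) != t -> f t = 0) ->
  has_sum (f \o h) l -> has_sum f l.
Proof.
move=> hK f0 fl U /fl[A _ AU].
exists [fset h s | s in A]%fset => // B /= hAB.
(* Only the part of [B] in the image of [h] contributes, and [h'] carries it injectively onto a
   finite set containing [A]. *)
pose D := [fset t in B | h (h' t) == t]%fset.
have h'D : {in D &, injective h'}.
  move=> t t'; rewrite !inE /= => /andP[_ /eqP<-] /andP[_ /eqP<-].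
  by rewrite !hK => ->.
have -> : partial_sum f B = partial_sum (f \o h) [fset h' t | t in D]%fset.
  rewrite !partial_sumE big_imfset //= (big_fsetID _ (fun t => h (h' t) == t)) /=.
  rewrite [X in _ + X]big1_fset ?addr0; last first.
    by move=> t; rewrite !inE /= => /andP[_ /f0].
  by apply: eq_fbigr => t; rewrite !inE /= => /andP[_ /eqP->].
apply: AU => /=; apply/fsubsetP => s sA; apply/imfsetP; exists (h s) => /=.
  by rewrite !inE hK eqxx andbT; apply: (fsubsetP hAB); apply/imfsetP; exists s.
by rewrite hK.
Qed.

Lemma has_sum_single (T : choiceType) V (a : T) (v : V) :
  has_sum (fun i => if i == a then v else 0) v.
Proof.
move=> U Uv; exists [fset a]%fset => // B /=; rewrite fsub1set => aB.
rewrite partial_sumE (big_fsetD1 a) //= eqxx big1_fset ?addr0 //.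
  exact: nbhs_singleton.
by move=> i; rewrite !inE => /andP[/negPf-> _].
Qed.

(** Every partial sum over a set containing [a] is already at least [f a]. A single positive term
    will thus make a whole sum positive. *)
Lemma has_sum_ge_term (T : choiceType) (f : T -> K) (l : K) (a : T) :
  (forall i, 0 <= f i) -> has_sum f l -> f a <= l.
Proof.
move=> f0 fl; apply: (cvgr_to_ge fl).
exists [fset a]%fset => // B /=; rewrite fsub1set => aB.
by rewrite partial_sumE (big_fsetD1 a) //= lerDl sumr_ge0.
Qed.

End HasSum.

(** * The Euclidean inner product on row vectors *)

Section Dot.
Context {R : realType} {N : nat}.
Implicit Types a b c : 'rV[R]_N.

Lemma dotC a b : dot a b = dot b a.
Proof. by apply: eq_bigr => k _; rewrite mulrC. Qed.

Lemma dotDr a b c : dot a (b + c) = dot a b + dot a c.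
Proof. by rewrite -big_split; apply: eq_bigr => k _; rewrite !mxE mulrDr. Qed.

Lemma dotZr (k : R) a b : dot a (k *: b) = k * dot a b.
Proof. by rewrite mulr_sumr; apply: eq_bigr => j _; rewrite !mxE mulrCA. Qed.

Lemma dotDl a b c : dot (a + b) c = dot a c + dot b c.
Proof. by rewrite dotC dotDr !(dotC c). Qed.

Lemma dotZl (k : R) a b : dot (k *: a) b = k * dot a b.
Proof. by rewrite dotC dotZr dotC. Qed.

Lemma dot0l a : dot 0 a = 0.
Proof. by rewrite -(scale0r 0) dotZl mul0r. Qed.

Lemma dotNr a b : dot a (- b) = - dot a b.
Proof. by rewrite -scaleN1r dotZr mulN1r. Qed.

Lemma sqnormD a b : sqnorm (a + b) = sqnorm a + 2 * dot a b + sqnorm b.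
Proof. by rewrite /sqnorm dotDl !dotDr (dotC b a); ring. Qed.

Lemma sqnormZ (k : R) a : sqnorm (k *: a) = k ^+ 2 * sqnorm a.
Proof. by rewrite /sqnorm dotZl dotZr mulrA. Qed.

Lemma sqnormN a : sqnorm (- a) = sqnorm a.
Proof. by rewrite -scaleN1r sqnormZ sqrrN expr1n mul1r. Qed.

Lemma sqnorm0 : sqnorm (0 : 'rV[R]_N) = 0.
Proof. exact: dot0l. Qed.

Lemma sqnorm_ge0 a : 0 <= sqnorm a.
Proof. by apply: sumr_ge0 => k _; rewrite -expr2 sqr_ge0. Qed.

Lemma sqnorm_eq0 a : (sqnorm a == 0) = (a == 0).
Proof.
apply/eqP/eqP => [/eqP|->]; last exact: sqnorm0.
rewrite psumr_eq0 => [/allP a0|k _]; last by rewrite -expr2 sqr_ge0.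
apply/rowP => k; rewrite mxE; apply/eqP.
by have := a0 k (mem_index_enum _); rewrite /= mulf_eq0 orbb.
Qed.

(** Lets the inner product with a fixed vector pass through infinite sums by [has_sum_map]. *)
Lemma dot_continuous a : continuous (dot a).
Proof.
move=> b; rewrite /dot /=.
apply: (@continuous_big _ _ +%R 0) => [|k _]; first exact: add_continuous.
move=> c; exact: (continuous_comp (@coord_continuous R 1 N 0 k c)
  (@mulrl_continuous R (a 0 k) _)).
Qed.

End Dot.

(** * Energies and harmonic offset in terms of moments of the weights *)

Section Splitting.
Context {R : realType} {N : nat} (u : N.-tuple 'rV[R]_N).
Variables (I : set 'rV[int]_N) (p q : R).
Hypothesis I_half : half_lattice I.
Implicit Types (w : 'rV[int]_N -> R) (i j : 'rV[int]_N) (x z : 'rV[R]_N).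

Lemma half_lattice0 : 0 \notin I.
Proof. by rewrite notin_setE; case: I_half. Qed.

Lemma half_latticeN i : i != 0 -> (- i \in I) = (i \notin I).
Proof.
case: I_half => cover disj _ _ i0; apply/idP/idP => [|iI].
  rewrite inE => NiI; rewrite notin_setE => iI.
  suff : (I `&` [set - j | j in I]) i by rewrite disj.
  by split => //; exists (- i) => //; rewrite opprK.
have : setT i by []; rewrite -cover => -[[iI'|[j jI <-]]|/= ii].
- by move: iI; rewrite notin_setE.
- by rewrite opprK inE.
- by rewrite ii eqxx in i0.
Qed.

Lemma latvecD i j : latvec u (i + j) = latvec u i + latvec u j.
Proof.
rewrite -big_split; apply: eq_bigr => k _ /=.
by rewrite mxE rmorphD /= scalerDl.
Qed.

Lemma latvecN i : latvec u (- i) = - latvec u i.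
Proof.
rewrite -sumrN; apply: eq_bigr => k _ /=.
by rewrite mxE rmorphN /= scaleNr.
Qed.

Lemma latvec0 : latvec u 0 = 0.
Proof. by rewrite /latvec big1 // => k _; rewrite mxE scale0r. Qed.

Lemma latvec_eq0 i : basis_of fullv u -> latvec u i = 0 -> i = 0.
Proof.
move=> /basis_free/freeP ufree i0; apply/rowP => k; apply/eqP.
rewrite mxE -(intr_eq0 R); apply/eqP; apply: (ufree (fun k => (i 0 k)%:~R)).
by rewrite -[RHS]i0; apply: eq_bigr => j _; rewrite (tnth_nth 0).
Qed.

(** The two energies and the offset depend on [w] only through these sums and [w 0]. Keeping the
    limits as parameters lets them pass to affine combinations by linearity, which is how the
    interpolated weights are handled. *)
Record has_moments w (S : R) (z : 'rV[R]_N) (E : R) : Prop := HasMoments {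
  moments_sym : forall i, w (- i) = w i;
  moment0 : has_sum (extend0 I w) S;
  moment1 : has_sum (extend0 I (fun i => w i *: latvec u i)) z;
  moment2 : has_sum (extend0 I (fun i => w i * sqnorm (latvec u i))) E
}.

Lemma weight_system_moments w :
  weight_system u I w -> exists S z E, has_moments w S z E.
Proof. by case=> _ sym _ [S S_] [z z_] [E E_]; exists S, z, E; split. Qed.

Lemma has_moments_interpolate w0 w1 S0 S1 z0 z1 E0 E1 s :
  has_moments w0 S0 z0 E0 -> has_moments w1 S1 z1 E1 ->
  has_moments (interpolate w0 w1 s) ((1 - s) * S0 + s * S1)
    ((1 - s) *: z0 + s *: z1) ((1 - s) * E0 + s * E1).
Proof.
move=> [sym0 S0_ z0_ E0_] [sym1 S1_ z1_ E1_]; split.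
- by move=> i; rewrite /interpolate sym0 sym1.
- apply: eq_has_sum (has_sumD (has_sumM (a := 1 - s) S0_) (has_sumM (a := s) S1_)) => i.
  by rewrite /extend0; case: ifP; rewrite // !mulr0 addr0.
- apply: eq_has_sum (has_sumD (has_sumZ (a := 1 - s) z0_) (has_sumZ (a := s) z1_)) => i.
  rewrite /extend0; case: ifP; rewrite ?scaler0 ?addr0 // => _.
  by rewrite !scalerA -scalerDl.
- apply: eq_has_sum (has_sumD (has_sumM (a := 1 - s) E0_) (has_sumM (a := s) E1_)) => i.
  rewrite /extend0; case: ifP; rewrite ?mulr0 ?addr0 // => _.
  by rewrite /interpolate; ring.
Qed.

(** As 0 is not in [I], the split weight is [w] on [I] plus a single term at 0, the former loop. For
    [F] equal to 1, [latvec] and its squared norm this gives three moments; the loop term survives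
    only in the first, since [latvec 0] is 0. *)
Lemma has_sum_split_weight (V : normedModType R) w (F : 'rV[int]_N -> V) l :
  has_sum (extend0 I (fun i => w i *: F i)) l ->
  has_sum (fun i => split_weight I p w i *: F i) ((p * w 0) *: F 0 + l).
Proof.
move=> Fl; apply: eq_has_sum (has_sumD (has_sum_single 0 (v := (p * w 0) *: F 0)) Fl) => i.
rewrite /split_weight /extend0; case: eqP => [->|_].
  by rewrite (negPf half_lattice0) addr0.
by case: ifP; rewrite ?add0r ?scale0r.
Qed.

Section Moments.
Variables (w : 'rV[int]_N -> R) (S : R) (z : 'rV[R]_N) (E : R).
Hypothesis wM : has_moments w S z E.

Let W := p * w 0 + S.

Lemma zvec_moments : zvec u I w = z.
Proof. exact: has_sum_sum (moment1 wM). Qed.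

Lemma Wbar_moments : Wbar I p w = W.
Proof. by congr (_ + _); exact: has_sum_sum (moment0 wM). Qed.

(** The edges leaving a vertex are indexed by all of Z^N, and exactly one of i and -i lies in [I]
    when i is nonzero. The sum therefore runs through [I] twice, which the factor 1/2 in [energy]
    compensates. *)
Lemma energy_X0 : energy (X0 w) (Phi0 u) = E.
Proof.
rewrite /energy (big_pred1 tt) => [|[] //].
pose e := extend0 I (fun i => w i * sqnorm (latvec u i)).
have e0 : has_sum (fun i => e i + e (- i)) (E + E).
  apply: has_sumD (moment2 wM) _.
  apply: (has_sum_reindex (h := -%R) (h' := -%R)) => [|i|]; first exact: opprK.
    by rewrite opprK eqxx.
  by apply: eq_has_sum (moment2 wM) => i; rewrite /= opprK.
rewrite (has_sum_sum (l := E + E)); first by field.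
apply: (has_sum_reindex (h := fun i => (i, tt)) (h' := fst)) => [//|[i []]|].
  by rewrite eqxx.
apply: eq_has_sum e0 => i.
rewrite /e /extend0 /X0 /Phi0 /= subr0 latvec0 subr0 latvecN sqnormN (moments_sym wM).
have [->|i0] := eqVneq i 0.
  by rewrite oppr0 (negPf half_lattice0) latvec0 sqnorm0 mulr0 addr0.
by rewrite half_latticeN //; case: (i \in I); rewrite ?addr0 ?add0r.
Qed.

Lemma has_sum_split0 : has_sum (split_weight I p w) W.
Proof.
have /(has_sum_split_weight (F := fun=> 1 : R)) :
    has_sum (extend0 I (fun i => w i *: (1 : R))) S.
  by apply: eq_has_sum (moment0 wM) => i; rewrite /extend0 /GRing.scale /= mulr1.
rewrite /GRing.scale /= mulr1.
by apply: eq_has_sum => i; rewrite mulr1.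
Qed.

Lemma has_sum_split1 : has_sum (fun i => split_weight I p w i *: latvec u i) z.
Proof.
by have := has_sum_split_weight (moment1 wM); rewrite latvec0 scaler0 add0r.
Qed.

Lemma has_sum_split2 :
  has_sum (fun i => split_weight I p w i * sqnorm (latvec u i)) E.
Proof.
have := has_sum_split_weight (V := R) (F := fun i => sqnorm (latvec u i))
  (moment2 wM).
by rewrite latvec0 sqnorm0 scaler0 add0r.
Qed.

(** In [X1] an edge leaving (j, 1) goes from v_j + x to v_j + v_i, so its vector is [latvec i - x]
    whatever j is. *)
Lemma has_sum_outgoing x :
  has_sum (fun i => split_weight I p w i *: (latvec u i - x)) (z - W *: x).
Proof.
have Wx := has_sumZl (v := x) has_sum_split0.
apply: eq_has_sum (has_sumD has_sum_split1 (has_sumN Wx)) => i.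
by rewrite scalerBr.
Qed.

Lemma has_sum_split_energy x :
  has_sum (fun i => split_weight I p w i * sqnorm (latvec u i - x))
    (E - 2 * dot x z + sqnorm x * W).
Proof.
have dotz := has_sum_map (dotDr x) (@dot_continuous R N x) has_sum_split1.
have xW := has_sumM (a := sqnorm x) has_sum_split0.
apply: eq_has_sum (has_sumD (has_sumD has_sum_split2
  (has_sumN (has_sumM (a := 2) dotz))) xW) => i.
by rewrite /= dotZr sqnormD sqnormN dotNr (dotC _ x); ring.
Qed.

(** The edges at (j, 0) are, up to translation, those at (j, 1) reversed, so the two kinds of
    vertices give opposite sums and one common condition. Loops have edge vector 0. *)
Lemma harmonic_X1 x : harmonic (X1 I p q w) (Phi1 u x) <-> z = W *: x.
Proof.
have out j : has_sum (fun y => X1 I p q w (j, true) y *: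
    (Phi1 u x y - Phi1 u x (j, true))) (z - W *: x).
  apply: (has_sum_reindex (h := fun i => (j + i, false)) (h' := fun y => y.1 - j)).
  - by move=> i /=; rewrite addrAC subrr add0r.
  - case=> i []; rewrite /= /X1 /Phi1 /= addrC subrK ?eqxx // => _.
    by case: eqP => [->|]; rewrite ?subrr ?scaler0 ?scale0r.
  apply: eq_has_sum (has_sum_outgoing (x := x)) => i.
  rewrite /X1 /Phi1 /= addrAC subrr add0r latvecD addr0; congr (_ *: _).
  by rewrite opprD addrACA subrr add0r.
have inn j : has_sum (fun y => X1 I p q w (j, false) y *:
    (Phi1 u x y - Phi1 u x (j, false))) (- (z - W *: x)).
  apply: (has_sum_reindex (h := fun i => (j - i, true)) (h' := fun y => j - y.1)).
  - by move=> i /=; rewrite subKr.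
  - case=> i []; rewrite /= /X1 /Phi1 /= subKr ?eqxx // => _.
    by case: eqP => [->|]; rewrite ?subrr ?scaler0 ?scale0r.
  apply: eq_has_sum (has_sumN (has_sum_outgoing (x := x))) => i.
  rewrite /X1 /Phi1 /= subKr latvecD latvecN addr0 -scalerN; congr (_ *: _).
  by rewrite opprB [RHS]addrAC (addrAC (latvec u j)) subrr add0r addrC.
split=> [harm|zW [j []]].
- by apply/eqP; rewrite -subr_eq0; apply/eqP/(has_sum_unique (out 0) (harm _)).
- by have := out j; rewrite zW subrr.
- by have := inn j; rewrite zW subrr oppr0.
Qed.

(** Each class of non-loop edges has one end of each kind, so both vertices of the period give the
    same sum, and the factor 1/2 leaves one copy. *)
Lemma energy_X1 x :
  energy (X1 I p q w) (Phi1 u x) = E - 2 * dot x z + sqnorm x * W.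
Proof.
have out : has_sum (fun y => X1 I p q w (0, true) y *
    sqnorm (Phi1 u x y - Phi1 u x (0, true))) (E - 2 * dot x z + sqnorm x * W).
  apply: (has_sum_reindex (h := fun i => (i, false)) (h' := fst)) => [//| |].
  - case=> i []; rewrite /X1 /Phi1 /= ?eqxx // => _.
    by case: eqP => [->|]; rewrite ?subrr ?sqnorm0 ?mulr0 ?mul0r.
  apply: eq_has_sum (has_sum_split_energy (x := x)) => i.
  by rewrite /X1 /Phi1 /= subr0 latvec0 addr0 add0r.
have inn : has_sum (fun y => X1 I p q w (0, false) y *
    sqnorm (Phi1 u x y - Phi1 u x (0, false))) (E - 2 * dot x z + sqnorm x * W).
  apply: (has_sum_reindex (h := fun i => (- i, true)) (h' := fun y => - y.1)).
  - by move=> i /=; rewrite opprK.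
  - case=> i []; rewrite /= /X1 /Phi1 /= opprK ?eqxx // => _.
    by case: eqP => [->|]; rewrite ?subrr ?sqnorm0 ?mulr0 ?mul0r.
  apply: eq_has_sum (has_sum_split_energy (x := x)) => i.
  rewrite /X1 /Phi1 /= sub0r opprK latvec0 addr0 subr0 latvecN.
  by rewrite -sqnormN opprB addrC.
rewrite /energy big_bool /= (has_sum_sum out) (has_sum_sum inn).
by field.
Qed.

Lemma energy_loss_ratioE : 0 < W ->
  energy_loss_ratio u I p q w = sqnorm z / (W * E).
Proof.
move=> W0; have Wn0 : W != 0 by rewrite gt_eqF.
have zW : z = W *: harmonic_offset u I p q w.
  apply/harmonic_X1; rewrite /harmonic_offset.
  (* [xget] falls back on its default 0 only for an empty set; the witness solves W x = z, which is
     possible since W is nonzero. *)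
  apply: (@xgetPex _ 0 [set x | harmonic (X1 I p q w) (Phi1 u x)]).
  by exists (W^-1 *: z); apply/harmonic_X1; rewrite scalerA divff ?scale1r.
rewrite /energy_loss_ratio energy_X0 energy_X1.
move: (harmonic_offset _ _ _ _ _) zW => x ->.
rewrite sqnormZ dotZr -/(sqnorm x) invfM [RHS]mulrA; congr (_ / _).
by field.
Qed.

End Moments.
End Splitting.

(** * Positivity of the total weight and of the energy *)

Section Positivity.
Context {R : realType} {N : nat} {u : N.-tuple 'rV[R]_N} {I : set 'rV[int]_N}.
Context {w : 'rV[int]_N -> R}.
Hypotheses (N_gt0 : (0 < N)%N) (u_basis : basis_of fullv u).
Hypotheses (I_half : half_lattice I) (w_system : weight_system u I w).

(* Otherwise every edge of positive weight is a loop, and 0 is not connected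
   to the other lattice points. *)
Lemma ex_weight_gt0 : exists2 i, i \in I & 0 < w i.
Proof.
case: w_system => _ w_sym w_conn _ _ _.
suff [i i0 wi] : exists2 i, i != 0 & 0 < w i.
  have [iI|iI] := boolP (i \in I); first by exists i.
  by exists (- i); rewrite ?w_sym ?half_latticeN.
apply: contrapT => noi.
have step x y : 0 < X0 w x y -> y.1 = x.1.
  move=> wxy; apply/eqP; rewrite -subr_eq0; apply: contra_notT noi => xy.
  by exists (y.1 - x.1).
have stay s : forall x, path (fun a b => 0 < X0 w a b) x s ->
    (last x s).1 = x.1.
  by elim: s => //= y s IH x /andP[/step<- /IH].
have [s [/stay + slast]] := w_conn (0, tt) (const_mx 1, tt).
by rewrite slast => /= /rowP/(_ (Ordinal N_gt0)); rewrite !mxE.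
Qed.

(** One label in [I] of positive weight bounds both sums below. For the energy, its edge vector is
    nonzero because the period vectors are linearly independent. *)
Lemma moments_gt0 S z E : has_moments u I w S z E -> 0 < S /\ 0 < E.
Proof.
move=> wM; have [i iI wi] := ex_weight_gt0.
have w_ge0 := weight_ge0 w_system.
split.
  apply: (lt_le_trans wi).
  have -> : w i = extend0 I w i by rewrite /extend0 iI.
  apply: has_sum_ge_term (moment0 wM) => j.
  by rewrite /extend0; case: ifP.
have i0 : i != 0 by apply: contraTneq iI => ->; exact: half_lattice0.
have Ei : 0 < w i * sqnorm (latvec u i).
  rewrite mulr_gt0 // lt_neqAle sqnorm_ge0 eq_sym sqnorm_eq0 andbT.
  by apply: contraNneq i0 => /(latvec_eq0 u_basis)->.
apply: (lt_le_trans Ei).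
have -> : w i * sqnorm (latvec u i) =
    extend0 I (fun i => w i * sqnorm (latvec u i)) i by rewrite /extend0 iI.
apply: has_sum_ge_term (moment2 wM) => j.
by rewrite /extend0; case: ifP => // _; rewrite mulr_ge0 ?sqnorm_ge0.
Qed.

End Positivity.

(** * The ratio along a segment, as a problem on real numbers and two vectors *)

Section LinearPath.
Context {R : realType} {N : nat}.
Variables (W0 W1 E0 E1 r : R) (z0 z1 : 'rV[R]_N).
Hypotheses (W0_gt0 : 0 < W0) (W1_gt0 : 0 < W1).
Hypotheses (E0_gt0 : 0 < E0) (E1_gt0 : 0 < E1).
Hypotheses (z0E : sqnorm z0 = r * (W0 * E0)) (z1E : sqnorm z1 = r * (W1 * E1)).

Let WE s := ((1 - s) * W0 + s * W1) * ((1 - s) * E0 + s * E1).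
Let ratio s := sqnorm ((1 - s) *: z0 + s *: z1) / WE s.
Let D := (W0 * E1 + W1 * E0) * r - 2 * dot z0 z1.
Let t0 := Num.sqrt (W0 * E0).
Let t1 := Num.sqrt (W1 * E1).
Let shat := t0 / (t0 + t1).

Lemma convex_gt0 (a b s : R) :
  0 < a -> 0 < b -> 0 <= s <= 1 -> 0 < (1 - s) * a + s * b.
Proof. by move=> a0 b0 /andP[s0 s1]; nra. Qed.

Let WE_gt0 s : 0 <= s <= 1 -> 0 < WE s.
Proof. by move=> s01; rewrite mulr_gt0 // convex_gt0. Qed.

Let t0_gt0 : 0 < t0. Proof. by rewrite sqrtr_gt0 mulr_gt0. Qed.
Let t1_gt0 : 0 < t1. Proof. by rewrite sqrtr_gt0 mulr_gt0. Qed.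
Let t0E : t0 ^+ 2 = W0 * E0. Proof. by rewrite sqr_sqrtr // mulr_ge0 // ltW. Qed.
Let t1E : t1 ^+ 2 = W1 * E1. Proof. by rewrite sqr_sqrtr // mulr_ge0 // ltW. Qed.

Lemma ratio_ge0 : 0 <= r.
Proof. by rewrite -(pmulr_lge0 _ (mulr_gt0 W0_gt0 E0_gt0)) -z0E sqnorm_ge0. Qed.

Lemma ratio_path s : 0 <= s <= 1 -> ratio s = r - (1 - s) * s / WE s * D.
Proof.
move=> s01; have WE0 : WE s != 0 by rewrite gt_eqF ?WE_gt0.
apply: (mulIf WE0); rewrite /ratio divfK // mulrBl.
rewrite [_ * D * _]mulrAC divfK //.
rewrite sqnormD !sqnormZ dotZl dotZr z0E z1E /WE /D; ring.
Qed.

(* This vector vanishes exactly in the case of equality in Cauchy-Schwarz, since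
   [|z_k| = sqrt r * t_k]. *)
Lemma sqnorm_defect :
  sqnorm (t1 *: z0 - t0 *: z1) = 2 * (t0 * t1) * (t0 * t1 * r - dot z0 z1).
Proof.
rewrite sqnormD sqnormN !sqnormZ dotNr dotZl dotZr z0E z1E -t0E -t1E; ring.
Qed.

(** AM-GM for [W0 * E1] and [W1 * E0], whose geometric mean is [t0 * t1]: after squaring, the
    difference of the two sides is a square. *)
Let mean_ge : 2 * (t0 * t1) <= W0 * E1 + W1 * E0.
Proof.
rewrite -(ler_pXn2r (n := 2)) ?nnegrE ?addr_ge0 ?mulr_ge0 ?(ltW t0_gt0)
  ?(ltW t1_gt0) ?(ltW W0_gt0) ?(ltW W1_gt0) ?(ltW E0_gt0) ?(ltW E1_gt0) //.
rewrite !exprMn t0E t1E -subr_ge0.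
by rewrite (_ : _ - _ = (W0 * E1 - W1 * E0) ^+ 2) ?sqr_ge0 //; ring.
Qed.

Let dot_le : dot z0 z1 <= t0 * t1 * r.
Proof.
have := sqnorm_ge0 (t1 *: z0 - t0 *: z1).
by rewrite sqnorm_defect pmulr_rge0 ?mulr_gt0 // subr_ge0.
Qed.

(* The two summands are nonnegative by AM-GM and by Cauchy-Schwarz. *)
Let defectE : D = (W0 * E1 + W1 * E0 - 2 * (t0 * t1)) * r
  + 2 * (t0 * t1 * r - dot z0 z1).
Proof. by rewrite /D; ring. Qed.

Lemma defect_ge0 : 0 <= D.
Proof.
by rewrite defectE addr_ge0 ?mulr_ge0 ?subr_ge0 ?ratio_ge0.
Qed.

Lemma ratio_le s : 0 <= s <= 1 -> ratio s <= r.
Proof.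
move=> s01; rewrite ratio_path // gerBl mulr_ge0 ?defect_ge0 //.
apply: divr_ge0 (ltW (WE_gt0 s01)).
by case/andP: s01 => s0 s1; rewrite mulr_ge0 // subr_ge0.
Qed.

Let defect_r0 : r = 0 -> D = 0.
Proof.
move=> r0; have /eqP : sqnorm z0 = 0 by rewrite z0E r0 mul0r.
by rewrite sqnorm_eq0 /D r0 mulr0 => /eqP->; rewrite dot0l mulr0 subrr.
Qed.

(** When [r] is positive, [D] vanishes iff both summands of [defectE] do: equality in AM-GM gives
    the equal quotients, equality in Cauchy-Schwarz gives [t1 *: z0 = t0 *: z1]. *)
Lemma defect_eq0 :
  D = 0 <-> r = 0 \/ (E0 / W0 = E1 / W1 /\ same_direction z0 z1).
Proof.
have n0 : [/\ W0 != 0, W1 != 0, t0 != 0 & t1 != 0] by rewrite !gt_eqF.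
case: n0 => W0n W1n t0n t1n.
split=> [/eqP|[r0|[EW [c c0 z1c]]]].
- have := ratio_ge0; rewrite le_eqVlt => /orP[/eqP<-|r0]; first by left.
  rewrite defectE paddr_eq0 ?mulr_ge0 ?subr_ge0 ?ratio_ge0 //.
  rewrite mulf_eq0 (gt_eqF r0) orbF => /andP[/eqP mean0 dot0]; right; split.
    apply/eqP; rewrite eqr_div // -subr_eq0 -sqrf_eq0.
    suff -> : (E0 * W1 - E1 * W0) ^+ 2 = 0 by [].
    have -> : (E0 * W1 - E1 * W0) ^+ 2 =
      (W0 * E1 + W1 * E0) ^+ 2 - 4 * ((W0 * E0) * (W1 * E1)) by ring.
    have -> : W0 * E1 + W1 * E0 = 2 * (t0 * t1) by lra.
    by rewrite -t0E -t1E; ring.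
  (* The factor is forced by the lengths of the two vectors, which are in the ratio t1 to t0. *)
  exists (t1 / t0); first by rewrite divr_gt0.
  have : sqnorm (t1 *: z0 - t0 *: z1) == 0.
    move: dot0; rewrite sqnorm_defect !mulf_eq0 => /orP[|->]; rewrite ?orbT //.
    by rewrite pnatr_eq0.
  rewrite sqnorm_eq0 subr_eq0 mulrC => /eqP t10.
  by rewrite -scalerA t10 scalerA mulVf ?scale1r.
- exact: defect_r0.
- have [/defect_r0 //|r0] := eqVneq r 0.
  (* Conversely, comparing squared lengths identifies [c] with t1 / t0; the equal quotients then
     make [W0 * E1] and [W1 * E0] both equal to t0 t1, that is to c t0^2. *)
  have c2 : t1 ^+ 2 = (c * t0) ^+ 2.
    apply: (mulfI r0); rewrite exprMn t1E t0E -z1E z1c sqnormZ z0E; ring.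
  have t1c : t1 = c * t0.
    by apply/eqP; rewrite -(eqrXn2 (n := 2)) ?c2 ?mulr_ge0 ?(ltW c0)
      ?(ltW t0_gt0) ?(ltW t1_gt0).
  have W1E0 : W1 * E0 = W0 * E1.
    move/eqP: EW; rewrite eqr_div // => /eqP.
    by rewrite [W1 * _]mulrC [W0 * _]mulrC.
  have cW : W0 * E1 = c * (W0 * E0).
    have : (W0 * E1) ^+ 2 = (c * (W0 * E0)) ^+ 2.
      transitivity (t0 ^+ 2 * t1 ^+ 2).
        by rewrite t0E t1E expr2 -{2}W1E0; ring.
      by rewrite c2 -t0E; ring.
    move/eqP; rewrite eqrXn2 ?mulr_ge0 ?(ltW c0) ?(ltW W0_gt0) ?(ltW E0_gt0)
      ?(ltW E1_gt0) // => /eqP //.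
  rewrite /D W1E0 cW z1c dotZr -/(sqnorm z0) z0E; ring.
Qed.

Lemma shat_itv : 0 <= shat <= 1.
Proof.
rewrite divr_ge0 ?addr_ge0 ?(ltW t0_gt0) ?(ltW t1_gt0) //= ler_pdivrMr ?addr_gt0 //.
by rewrite mul1r lerDl (ltW t1_gt0).
Qed.

Lemma ratio_shat_le s : 0 <= s <= 1 -> ratio shat <= ratio s.
Proof.
move=> s01; rewrite !ratio_path ?shat_itv // lerD2l lerN2.
apply: ler_wpM2r; first exact: defect_ge0.
have t01 : t0 + t1 != 0 by rewrite gt_eqF ?addr_gt0.
have A_gt0 : 0 < 2 * (t0 * t1) + (W0 * E1 + W1 * E0).
  by rewrite !addr_gt0 ?mulr_gt0.
(* [shat] is the point where the square below vanishes. *)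
have WEE x : WE x = ((1 - x) * t0 - x * t1) ^+ 2
    + (1 - x) * x * (2 * (t0 * t1) + (W0 * E1 + W1 * E0)).
  by transitivity ((1 - x) ^+ 2 * t0 ^+ 2 + x ^+ 2 * t1 ^+ 2
    + (1 - x) * x * (W0 * E1 + W1 * E0)); [rewrite t0E t1E /WE|]; ring.
have -> : (1 - shat) * shat / WE shat
    = (2 * (t0 * t1) + (W0 * E1 + W1 * E0))^-1.
  have -> : WE shat
      = (1 - shat) * shat * (2 * (t0 * t1) + (W0 * E1 + W1 * E0)).
    by rewrite WEE (_ : _ - _ = 0) ?expr0n ?add0r // /shat; field.
  rewrite invfM [LHS]mulrA divff ?mul1r //.
  have -> : 1 - shat = t1 / (t0 + t1) by rewrite /shat; field.
  by rewrite !mulf_neq0 ?invr_neq0 // gt_eqF.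
(* With denominators cleared, the bound says that [WE s] is at least its second summand in [WEE];
   the difference is the square. *)
by rewrite ler_pdivrMr ?WE_gt0 // [leRHS]mulrC ler_pdivlMr // WEE lerDr sqr_ge0.
Qed.

End LinearPath.

(* If z 0 = z 1 = 0, then all ratios vanish, whatever the quotients E / W are;
   hence the alternative [Rat 0 = 0] in the equality case. *)
Theorem proposition8p5 (R : realType) (N : nat) (u : N.-tuple 'rV[R]_N)
    (I : set 'rV[int]_N) (p q : R) (w0 w1 : 'rV[int]_N -> R)
    (N_gt0 : (0 < N)%N)
    (u_basis : basis_of fullv u)
    (I_half : half_lattice I)
    (p01 : 0 <= p <= 1)
    (q01 : 0 <= q <= 1)
    (w0_system : weight_system u I w0)
    (w1_system : weight_system u I w1) :
  let w := interpolate w0 w1 in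
  let E := fun s => energy (X0 (w s)) (Phi0 u) in
  let z := fun s => zvec u I (w s) in
  let W := fun s => Wbar I p (w s) in
  let Rat := fun s => energy_loss_ratio u I p q (w s) in
  let shat := Num.sqrt (W 0 * E 0)
                / (Num.sqrt (W 0 * E 0) + Num.sqrt (W 1 * E 1)) in
  Rat 0 = Rat 1 ->
  [/\ forall s : R, 0 <= s <= 1 ->
        Rat s = Rat 0 - (1 - s) * s / (W s * E s)
                  * ((W 0 * E 1 + W 1 * E 0) * Rat 0 - 2 * dot (z 0) (z 1))
        /\ Rat s <= Rat 0,
      forall s : R, 0 < s < 1 ->
        (Rat s = Rat 0 <->
         Rat 0 = 0 \/
         (E 0 / W 0 = E 1 / W 1 /\ same_direction (z 0) (z 1))) &
      0 <= shat <= 1 /\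
      forall s : R, 0 <= s <= 1 -> Rat shat <= Rat s].

Proof.
move=> w E z W Rat shat.
have [S0 [v0 [F0 M0]]] := weight_system_moments w0_system.
have [S1 [v1 [F1 M1]]] := weight_system_moments w1_system.
have [S0_gt0 F0_gt0] := moments_gt0 N_gt0 u_basis I_half w0_system M0.
have [S1_gt0 F1_gt0] := moments_gt0 N_gt0 u_basis I_half w1_system M1.
have Ms s := has_moments_interpolate s M0 M1.
have EE s : E s = (1 - s) * F0 + s * F1 by exact: energy_X0 (Ms s).
have zE s : z s = (1 - s) *: v0 + s *: v1 by exact: zvec_moments (Ms s).
pose Wb (v : 'rV[int]_N -> R) S := p * v 0 + S.
have WE s : W s = (1 - s) * Wb w0 S0 + s * Wb w1 S1.
  by rewrite [W s](Wbar_moments p (Ms s)) /Wb /interpolate; ring.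
have [p0 _] := andP p01.
have Wb0 : 0 < Wb w0 S0.
  by rewrite ltr_wpDl // mulr_ge0 // (weight_ge0 w0_system).
have Wb1 : 0 < Wb w1 S1.
  by rewrite ltr_wpDl // mulr_ge0 // (weight_ge0 w1_system).
have RatE s : 0 <= s <= 1 -> Rat s = sqnorm (z s) / (W s * E s).
  (* Convexity keeps [W s] positive on [0, 1], as solving for the offset requires. *)
  move=> s01; have Ws : 0 < W s by rewrite WE convex_gt0.
  rewrite EE zE; move: Ws; rewrite [W s](Wbar_moments p (Ms s)).
  exact: (energy_loss_ratioE (p := p) q I_half (Ms s)).
have at0 : [/\ W 0 = Wb w0 S0, E 0 = F0 & z 0 = v0].
  by rewrite WE EE zE subr0 !mul1r !mul0r scale1r scale0r !addr0.
have at1 : [/\ W 1 = Wb w1 S1, E 1 = F1 & z 1 = v1].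
  by rewrite WE EE zE subrr !mul1r !mul0r scale1r scale0r !add0r.
case: at0 at1 => W0E E0E z0E [W1E E1E z1E] Rat01.
have i0 : 0 <= (0 : R) <= 1 by rewrite ?lexx ler01.
have i1 : 0 <= (1 : R) <= 1 by rewrite ?lexx ler01.
(* The assumption of equal ratios enters here: both endpoints satisfy |z_k|^2 = r W_k E_k with the
   same r, namely [Rat 0]. *)
have v0E : sqnorm v0 = Rat 0 * (Wb w0 S0 * F0).
  by rewrite RatE // W0E E0E z0E divfK // mulf_neq0 ?gt_eqF.
have v1E : sqnorm v1 = Rat 0 * (Wb w1 S1 * F1).
  by rewrite Rat01 RatE // W1E E1E z1E divfK // mulf_neq0 ?gt_eqF.
have formula s : 0 <= s <= 1 -> Rat s = Rat 0 - (1 - s) * s / (W s * E s)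
    * ((W 0 * E 1 + W 1 * E 0) * Rat 0 - 2 * dot (z 0) (z 1)).
  move=> s01; rewrite [LHS]RatE // W0E W1E E0E E1E z0E z1E WE EE zE.
  exact: ratio_path.
split=> [s s01|s /andP[s0 s1]|].
- split; first exact: formula.
  by rewrite [leLHS]RatE // WE EE zE; apply: ratio_le.
- have s01 : 0 <= s <= 1 by rewrite !ltW.
  (* Strictly inside the segment the coefficient of the defect is nonzero, so equality of the ratios
     means that the defect vanishes. *)
  have c0 : (1 - s) * s / (W s * E s) != 0.
    rewrite WE EE; apply: lt0r_neq0.
    by rewrite divr_gt0 ?mulr_gt0 ?convex_gt0 // subr_gt0.
  rewrite formula // W0E W1E E0E E1E z0E z1E.
  apply: (iff_trans _ (defect_eq0 Wb0 Wb1 F0_gt0 F1_gt0 v0E v1E)).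
  split=> [/eqP|->]; last by rewrite mulr0 subr0.
  by rewrite -subr_eq0 addrAC subrr sub0r oppr_eq0 mulf_eq0 (negPf c0) => /eqP.
- have sh01 : 0 <= shat <= 1 by rewrite /shat W0E W1E E0E E1E; exact: shat_itv.
  split=> // s s01; rewrite !RatE // !WE !EE !zE /shat W0E W1E E0E E1E.
  exact: (ratio_shat_le _ _ _ _ v0E v1E).
Qed.
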